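(* Let $\mathbf{u}\in\mathbb{R}^m$ be a fixed vector, let $\mathbf{R}\in\mathbb{R}^{m\times n}$ be a random matrix such that either each row $\mathbf{R}_i$ is sampled i.i.d. from an isotropic distribution $P$ on $\mathbb{R}^n$, or $\hat{\mathbf{R}}$ is a randomly generated matrix with orthogonal rows, and let $\mathbf{z}\in\mathbb{R}^n$ have coordinates $\mathbf{z}_i$ i.i.d. $\mathrm{Bernoulli}(0.5)$, independent of $\mathbf{R}$. Let $\mathbf{v}=\sqrt{2}\cdot\mathbf{z}\odot\left(\hat{\mathbf{R}}^T\mathbf{u}\right)$. Then $\mathbb{E}[\lVert\mathbf{v}\rVert^2]=\lVert\mathbf{u}\rVert^2$.
   Context: For a matrix $\mathbf{R}$ with nonzero rows $\mathbf{R}_i$, $\hat{\mathbf{R}}$ denotes the matrix whose $i$-th row is $\mathbf{R}_i/\lVert\mathbf{R}_i\rVert_2$. A distribution $P$ on $\mathbb{R}^n$ is isotropic if it is invariant under all orthogonal transformations (all directions equally likely), with no mass at the origin. ''Randomly generated matrix with orthogonal rows'' means $\hat{\mathbf{R}}$ has orthonormal rows (so $m\le n$), drawn uniformly over all rotations. $\odot$ is the coordinatewise (Hadamard) product. *)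

(* Defs.v *)
From HB Require Import structures.
From mathcomp Require Import all_boot all_order all_algebra.
From mathcomp Require Import all_classical all_reals all_analysis.
Set Implicit Arguments. Unset Strict Implicit. Unset Printing Implicit Defensive.
Import Order.TTheory GRing.Theory Num.Theory.
Import numFieldNormedType.Exports.
Local Open Scope classical_set_scope.
Local Open Scope ring_scope.

Definition borel_sets (V : topologicalType) : set (set V) :=
  smallest (sigma_algebra setT) open.

Section RandomElements.
Context {d : measure_display} {T : measurableType d} {R : realType}.

Definition rv_meas {V : topologicalType} (X : T -> V) : Prop :=
  forall A, borel_sets A -> measurable (X @^-1` A).

Definition sigma_of {V : topologicalType} (X : T -> V) : set (set T) :=
  [set X @^-1` A | A in borel_sets (V := V)].

Definition same_law (P : probability T R) {V : topologicalType}
  (X Y : T -> V) : Prop :=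
  forall A, borel_sets A -> P (X @^-1` A) = P (Y @^-1` A).

Definition mutually_independent (P : probability T R) {I : finType}
  (F : I -> set (set T)) : Prop :=
  forall E : I -> set T, (forall i, F i (E i)) ->
    P (\bigcap_(i in [set: I]) E i) = (\prod_(i : I) P (E i))%E.

Definition bernoulli_half (P : probability T R) (z : T -> R) : Prop :=
  P (z @^-1` [set 1]) = (1 / 2)%:E /\ P (z @^-1` [set 0]) = (1 / 2)%:E.

End RandomElements.

Definition orthogonal_mx {R : realType} {n : nat} (Q : 'M[R]_n) : Prop :=
  Q *m Q^T = 1%:M.

Definition isotropic_law {d : measure_display} {T : measurableType d}
  {R : realType} (P : probability T R) {n : nat} (X : T -> 'rV[R]_n) : Prop :=
  (forall Q : 'M[R]_n, orthogonal_mx Q -> same_law P X (fun w => X w *m Q))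
  /\ P (X @^-1` [set 0]) = 0%E.

Definition rnorm {R : realType} {n : nat} (x : 'rV[R]_n) : R :=
  Num.sqrt (\sum_(j < n) x ord0 j ^+ 2).

Definition rownormalize {R : realType} {m n : nat} (M : 'M[R]_(m, n))
  : 'M[R]_(m, n) :=
  \matrix_(i < m, j < n) (M i j / rnorm (row i M)).

Definition vvec {R : realType} {m n : nat} (M : 'M[R]_(m, n)) (z : 'I_n -> R)
  (u : 'cV[R]_m) : 'cV[R]_n :=
  \col_(j < n) (Num.sqrt 2 * z j * ((rownormalize M)^T *m u) j ord0).

Definition sqnorm {R : realType} {n : nat} (x : 'cV[R]_n) : R :=
  \sum_(j < n) x j ord0 ^+ 2.

(* Main.v *)
Require Import Defs.
From HB Require Import structures.
From mathcomp Require Import all_boot all_order all_algebra.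
From mathcomp Require Import all_classical all_reals all_analysis measurable_realfun.
From mathcomp Require Import ring.
Import Order.TTheory GRing.Theory Num.Theory.
Import numFieldTopology.Exports numFieldNormedType.Exports.
Local Open Scope classical_set_scope.
Local Open Scope ring_scope.

(* Since z_j^2 = 1_{z_j = 1} almost surely, with f = rownormalize R,
   |v|^2 = sum_{i,k} 2 u_i u_k sum_j 1_{z_j = 1} f_ij f_kj almost surely, so it
   suffices that E[sum_j 1_{z_j = 1} f_ij f_kj] = delta_ik / 2.  When
   sum_j f_ij f_kj = delta_ik almost surely (orthonormal rows, or i = k), this
   follows from the independence of z and R.  For distinct i.i.d. isotropic rows,
   f_ij is independent of 1_{z_j = 1} f_kj and has mean zero, because the law of
   row i is invariant under x |-> -x. *)

(** * Expectations of products of independent variables and of symmetric variables *)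

Section IndependentProducts.
Context {d : measure_display} {T : measurableType d} {R : realType}.
Variable P : probability T R.
Implicit Types X Y : T -> R.

Lemma integrable_le1 X :
    measurable_fun [set: T] X -> (forall w, `|X w| <= 1) ->
  P.-integrable [set: T] (EFin \o X).
Proof.
move=> mX X1; apply: measurable_bounded_integrable => //.
  by rewrite (le_lt_trans (probability_le1 P _)) ?ltry.
by exists 1; split=> // M M1 w _ /=; rewrite (le_trans (X1 w)) ?ltW.
Qed.

(** Independence says that the joint law agrees with the product of the marginal laws on rectangles,
    hence everywhere by uniqueness of the product measure. Fubini then splits the integral of
    [p.1 * p.2]. *)
Lemma expectationM_indep X Y :
    measurable_fun [set: T] X -> measurable_fun [set: T] Y ->
    P.-integrable [set: T] (EFin \o X) -> P.-integrable [set: T] (EFin \o Y) ->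
    P.-integrable [set: T] (EFin \o (X \* Y)) ->
    (forall A C : set R, measurable A -> measurable C ->
      P (X @^-1` A `&` Y @^-1` C) = P (X @^-1` A) * P (Y @^-1` C))%E ->
  ('E_P[X \* Y] = 'E_P[X] * 'E_P[Y])%E.
Proof.
move=> mX mY iX iY iXY indep.
pose X' : {mfun T >-> R} := HB.pack X (isMeasurableFun.Build _ _ _ _ X mX).
pose Y' : {mfun T >-> R} := HB.pack Y (isMeasurableFun.Build _ _ _ _ Y mY).
pose mu : probability _ R := distribution P X'.
pose nu : probability _ R := distribution P Y'.
have mXY : measurable_fun [set: T] (fun w => (X w, Y w)).
  exact: measurable_fun_pair.
have mf : measurable_fun [set: R * R] (fun p => p.1 * p.2).
  by apply: measurable_funM.
move/measurable_EFinP : mf; set f := (EFin \o _) => mf.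
have munuE A : measurable A -> A `<=` setT ->
    (mu \x nu)%E A = pushforward P (fun w => (X w, Y w)) A.
  move=> mA _; apply: (product_measure_unique (m' := pushforward P _)) => //.
have iXY' : (pushforward P (fun w => (X w, Y w))).-integrable setT f.
  by apply: integrable_pushforward.
have imunu : (mu \x nu)%E.-integrable setT f.
  apply/integrableP; split=> //; move/integrableP: iXY' => [_].
  by rewrite (eq_measure_integral _ munuE).
(* Finiteness makes the inner integral a real constant, which can be pulled out of the outer one. *)
have EYfin : (\int[nu]_y y%:E)%E \is a fin_num.
  rewrite /nu integral_distribution//; exact: integrable_fin_num.
transitivity (\int[mu]_x \int[nu]_y f (x, y))%E.
  rewrite (integral12_prod_meas1 imunu) (eq_measure_integral _ munuE).
  by rewrite integral_pushforward// unlock.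
have iY' : nu.-integrable setT (EFin : R -> \bar R).
  by apply: integrable_pushforward.
have iX' : mu.-integrable setT (EFin : R -> \bar R).
  by apply: integrable_pushforward.
under eq_integral => x _.
  under eq_integral => y _ do rewrite /f /= EFinM.
  rewrite integralZl// -(fineK EYfin).
  over.
rewrite integralZr// fineK// /mu /nu !integral_distribution//.
by rewrite unlock.
Qed.


(** Equality of the laws of [X] and [- X] gives E[X] = - E[X], and E[X] is finite. *)
Lemma expectation_symmetric X :
    measurable_fun [set: T] X -> P.-integrable [set: T] (EFin \o X) ->
    (forall A : set R, measurable A ->
      P (X @^-1` A) = P ((fun w => - X w) @^-1` A)) ->
  ('E_P[X] = 0)%E.
Proof.
move=> mX iX symX.
have mNX : measurable_fun [set: T] (fun w => - X w) by exact: measurableT_comp.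
have iNX : P.-integrable [set: T] (EFin \o (fun w => - X w)).
  by move/integrableN: iX; apply: eq_integrable.
have EX : ('E_P[X] = - 'E_P[X])%E.
  transitivity (\int[pushforward P X]_x x%:E)%E.
    by rewrite integral_pushforward// unlock.
  rewrite (eq_measure_integral (pushforward P (fun w => - X w))).
    by rewrite integral_pushforward// unlock -integralN ?integrable_add_def.
  by move=> A mA _; exact: symX.
have : ('E_P[X])%E \is a fin_num by rewrite unlock integrable_fin_num.
move: EX; case: ('E_P[X])%E => // r [] /eqP.
by rewrite -addr_eq0 -mulr2n mulrn_eq0/= => /eqP ->.
Qed.

(** The event that [\1_B \* Y] lies in [C] is built from [Y @^-1] C[,]B[and]~[B] alone, which is why
    [D] ranges over just two events. *)
Lemma indep_indicM X Y (B : set T) :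
    measurable_fun [set: T] X -> measurable_fun [set: T] Y -> measurable B ->
    (forall (A C : set R) D, measurable A -> measurable C ->
      D = B \/ D = ~` B ->
      P (X @^-1` A `&` (Y @^-1` C `&` D)) =
      P (X @^-1` A) * (P (Y @^-1` C) * P D))%E ->
  forall A C : set R, measurable A -> measurable C ->
    (P (X @^-1` A `&` (\1_B \* Y)%R @^-1` C) =
     P (X @^-1` A) * P ((\1_B \* Y)%R @^-1` C))%E.
Proof.
move=> mX mY mB indep A C mA mC.
have mXA : measurable (X @^-1` A) by rewrite -[X in measurable X]setTI; exact: mX.
have mYC : measurable (Y @^-1` C) by rewrite -[X in measurable X]setTI; exact: mY.
have mB' : measurable (~` B) by exact: measurableC.
(* Pairwise independence comes from the triple one by taking the remaining event to be [setT]. *)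
have YCB : P (Y @^-1` C `&` B) = (P (Y @^-1` C) * P B)%E.
  have := indep setT C B measurableT mC (or_introl erefl).
  by rewrite preimage_setT setTI probability_setT mul1e.
have XAB' : P (X @^-1` A `&` ~` B) = (P (X @^-1` A) * P (~` B))%E.
  have := indep A setT (~` B) mA measurableT (or_intror erefl).
  by rewrite preimage_setT setTI probability_setT mul1e.
have YCE : (\1_B \* Y)%R @^-1` C =
    (Y @^-1` C `&` B) `|` (if 0 \in C then ~` B else set0).
  apply/seteqP; split => w /=; rewrite indicE.
    case: (boolP (w \in B)) => [/set_mem Bw|/negP Bw]; rewrite ?mul1r ?mul0r.
      by left.
    by move=> C0; right; rewrite mem_set//= => Bw'; apply: Bw; exact: mem_set.
  case=> [[YC Bw]|]; first by rewrite mem_set// mul1r.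
  case: ifPn => // /set_mem C0 Bw.
  by rewrite memNset// mul0r.
rewrite YCE setIUr; case: ifPn => _; last first.
  by rewrite setI0 !setU0 indep ?YCB//; left.
have PU U V : measurable U -> measurable V -> U `&` V = set0 ->
    P (U `|` V) = (P U + P V)%E by exact: measureU.
rewrite !PU//; [rewrite indep; [|by []|by []|by left]|..].
- by rewrite YCB XAB' ge0_muleDr// mule_ge0.
- exact: measurableI.
- by rewrite -setIA setICr setI0.
- by do !apply: measurableI.
- exact: measurableI.
- by rewrite setIACA -(setIA (Y @^-1` C)) setICr !setI0.
Qed.

End IndependentProducts.

(** * Independence of finite subfamilies *)

Section MutualIndependence.
Context {d : measure_display} {T : measurableType d} {R : realType}.
Variable P : probability T R.

(** [mutually_independent] only speaks of full families of events; a subfamily is completed by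
    [setT], which contributes a factor 1. *)
Lemma mutually_independent_seq {I : finType} (F : I -> set (set T))
    (s : seq I) (E : I -> set T) :
    (forall i, F i setT) -> mutually_independent P F -> uniq s ->
    {in s, forall i, F i (E i)} ->
  P (\big[setI/setT]_(i <- s) E i) = (\prod_(i <- s) P (E i))%E.
Proof.
move=> FT indep us FE; pose E' i := if i \in s then E i else setT.
have FE' i : F i (E' i) by rewrite /E'; case: ifPn => // /FE.
transitivity (P (\bigcap_(i in [set: I]) E' i)).
  congr (P _); rewrite -bigcap_seq; apply/seteqP; split=> w h i /=.
    by move=> _; rewrite /E'; case: ifPn => // si; exact: h.
  by move=> si; have := h i Logic.I; rewrite /E' si.
rewrite indep// [RHS]big_uniq//= [RHS]big_mkcond/=.
by apply: eq_bigr => i _; rewrite /E'; case: ifPn => // _; rewrite probability_setT.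
Qed.

Lemma mutually_independent2 {I : finType} (F : I -> set (set T)) (a b : I) A B :
    (forall i, F i setT) -> mutually_independent P F -> a != b ->
    F a A -> F b B -> P (A `&` B) = (P A * P B)%E.
Proof.
move=> FT indep ab FA FB; pose E i := if i == a then A else B.
have Ea : E a = A by rewrite /E eqxx.
have Eb : E b = B by rewrite /E eq_sym (negbTE ab).
have := mutually_independent_seq F [:: a; b] E FT indep.
rewrite /= inE andbT ab !big_cons !big_nil setIT mule1 Ea Eb.
by apply=> // i; rewrite !inE => /orP[]/eqP ->; rewrite ?Ea ?Eb.
Qed.

Lemma mutually_independent3 {I : finType} (F : I -> set (set T)) (a b c : I)
    A B C :
    (forall i, F i setT) -> mutually_independent P F ->
    a != b -> a != c -> b != c -> F a A -> F b B -> F c C ->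
  P (A `&` (B `&` C)) = (P A * (P B * P C))%E.
Proof.
move=> FT indep ab ac bc FA FB FC.
pose E i := if i == a then A else if i == b then B else C.
have Ea : E a = A by rewrite /E eqxx.
have Eb : E b = B by rewrite /E eq_sym (negbTE ab) eqxx.
have Ec : E c = C by rewrite /E ![c == _]eq_sym (negbTE ac) (negbTE bc).
have := mutually_independent_seq F [:: a; b; c] E FT indep.
rewrite /= !inE negb_or ab ac bc !big_cons !big_nil setIT mule1 Ea Eb Ec.
by apply=> // i; rewrite !inE => /or3P[]/eqP ->; rewrite ?Ea ?Eb ?Ec.
Qed.

End MutualIndependence.

(** * Borel measurability of functions of a random element *)

Section Borel.
Context {d : measure_display} {T : measurableType d} {R : realType}.

(** The measurable sets of this type are those of [borel_sets], so that [measurable_fun] applies to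
    maps out of [V]. *)
Notation borel V := (g_sigma_algebraType (@open V)).

Lemma rv_meas_comp {V : ptopologicalType} (X : T -> V) (g : borel V -> R) :
  rv_meas X -> measurable_fun [set: borel V] g ->
  measurable_fun [set: T] (g \o X).
Proof.
move=> mX mg _ A mA; rewrite setTI; apply: (mX (g @^-1` A)).
by rewrite -[X in borel_sets X]setTI; exact: mg.
Qed.

Lemma sigma_of_comp {V : ptopologicalType} (X : T -> V) (g : borel V -> R)
    (A : set R) :
  measurable_fun [set: borel V] g -> measurable A -> sigma_of X ((g \o X) @^-1` A).
Proof.
move=> mg mA; exists (g @^-1` A) => //.
by rewrite -[X in borel_sets X]setTI; exact: mg.
Qed.

Lemma sigma_of_setT {V : ptopologicalType} (X : T -> V) : sigma_of X setT.
Proof. by exists setT; [exact: (@measurableT _ (borel V))|]. Qed.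

Lemma same_law_comp (P : probability T R) {V : ptopologicalType} (X Y : T -> V)
    (g : borel V -> R) (A : set R) :
  same_law P X Y -> measurable_fun [set: borel V] g -> measurable A ->
  P ((g \o X) @^-1` A) = P ((g \o Y) @^-1` A).
Proof.
move=> XY mg mA; apply: (XY (g @^-1` A)).
by rewrite -[X in borel_sets X]setTI; exact: mg.
Qed.

(** Open intervals generate the measurable sets of [R], and their preimages under [g] are open. *)
Lemma continuous_borel {V : ptopologicalType} (g : V -> R) :
  continuous g -> measurable_fun [set: borel V] g.
Proof.
move=> /continuousP cg; apply: (measurability _ (RGenOpens.measurableE R)).
move=> _ [_ [a [b ->] <-]]; rewrite setTI; apply: sub_sigma_algebra.
exact/cg/interval_open.
Qed.

Lemma measurable_set1_borel (r : R) : measurable ([set r] : set (borel R)).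
Proof.
rewrite -[X in measurable X]setCK; apply: measurableC.
apply: sub_sigma_algebra; rewrite openC.
exact/accessible_closed_set1/hausdorff_accessible/Rhausdorff.
Qed.

Lemma measurable_rownormalize {m n : nat} (i : 'I_m) (j : 'I_n) :
  measurable_fun [set: borel 'M[R]_(m, n)] (fun M => rownormalize M i j).
Proof.
have mcoord k : measurable_fun [set: borel 'M[R]_(m, n)] (fun M => M i k).
  by apply: continuous_borel; exact: coord_continuous.
pose S M := \sum_(k < n) row i M ord0 k ^+ 2 : R.
(* The inverse is written as a real power, which is measurable on all of [R]; the two agree on
   nonnegative numbers, including 0, where both are 0. *)
have -> : (fun M : 'M[R]_(m, n) => rownormalize M i j) =
    (fun M => M i j * Num.sqrt (S M) `^ (-1)).
  by apply/funext => M; rewrite mxE powR_inv1// sqrtr_ge0.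
apply: measurable_funM => //.
apply: (measurableT_comp (measurable_powR (-1))).
have msqrt : measurable_fun [set: R] (@Num.sqrt R).
  by apply: continuous_measurable_fun => x; exact: sqrt_continuous.
apply: (measurableT_comp msqrt).
apply: measurable_sum => k; apply: measurable_funX.
by under eq_fun do rewrite mxE; exact: mcoord.
Qed.

End Borel.

(** * Algebra of normalized rows *)

Section RowNormalize.
Context {R : realType} {m n : nat}.
Implicit Types M : 'M[R]_(m, n).

Lemma rownormalizeN M i j : rownormalize (- M) i j = - rownormalize M i j.
Proof.
rewrite !mxE mulNr; congr (- (_ / Num.sqrt _)).
by apply: eq_bigr => k _; rewrite !mxE sqrrN.
Qed.

Lemma rownormalize_row M i j :
  rownormalize (row i M) ord0 j = rownormalize M i j.
Proof. by rewrite !mxE row_id. Qed.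

Lemma rownormalize_le1 M i j : `|rownormalize M i j| <= 1.
Proof.
have rn_ge0 : 0 <= rnorm (row i M) by exact: sqrtr_ge0.
rewrite mxE normrM normfV (ger0_norm rn_ge0).
(* A zero row normalizes to 0 since the inverse of 0 is 0, so the bound needs no assumption on
   [M]. *)
have [->|r0] := eqVneq (rnorm (row i M)) 0; first by rewrite invr0 mulr0 ler01.
rewrite ler_pdivrMr ?lt_neqAle 1?eq_sym ?r0// mul1r.
rewrite -sqrtr_sqr ler_wsqrtr// (bigD1 j)//= mxE lerDl.
by apply: sumr_ge0 => k _; exact: sqr_ge0.
Qed.

Lemma sum_rownormalize_sqr M i : row i M != 0 ->
  \sum_j rownormalize M i j ^+ 2 = 1.
Proof.
move=> Mi0.
have SE : \sum_(j < n) row i M ord0 j ^+ 2 = \sum_(j < n) M i j ^+ 2.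
  by apply: eq_bigr => j _; rewrite mxE.
have S0 : 0 <= \sum_(j < n) M i j ^+ 2.
  by apply: sumr_ge0 => k _; exact: sqr_ge0.
under eq_bigr => j _ do rewrite mxE exprMn exprVn /rnorm SE sqr_sqrtr//.
rewrite -mulr_suml divff//; apply: contraNneq Mi0 => /eqP.
rewrite psumr_eq0 => [/allP S0'|k _]; last exact: sqr_ge0.
apply/eqP/rowP => k; have := S0' k (mem_index_enum _).
by rewrite sqrf_eq0 => /eqP Mik; rewrite !mxE.
Qed.

End RowNormalize.

(** Each squared coordinate expands into a double sum over pairs of rows; the factor 2 is the square
    of [Num.sqrt 2]. *)
Lemma sqnorm_vvec {R : realType} {m n : nat} (M : 'M[R]_(m, n)) (z : 'I_n -> R)
    (u : 'cV[R]_m) :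
  sqnorm (vvec M z u) = \sum_(p : 'I_m * 'I_m) 2 * u p.1 ord0 * u p.2 ord0 *
    \sum_j z j ^+ 2 * (rownormalize M p.1 j * rownormalize M p.2 j).
Proof.
under [RHS]eq_bigr do rewrite mulr_sumr.
rewrite exchange_big/=; apply: eq_bigr => j _.
rewrite mxE mxE !exprMn sqr_sqrtr// [X in _ * X]expr2 big_distrlr/= pair_bigA.
by rewrite mulr_sumr; apply: eq_bigr => p _ /=; rewrite !mxE; ring.
Qed.

(** * Reduction to the second moments of the masked normalized rows *)

Section SecondMoment.
Context {d : measure_display} {T : measurableType d} {R : realType}.
Variable P : probability T R.

(** By independence each term is [p] times the expectation of [X j]. Only the sum of these
    expectations is known, so they are recombined under one integral, whose integrand is almost
    surely [p * c]. *)
Lemma expectation_indic_sum {n : nat} (B : 'I_n -> set T) (X : 'I_n -> T -> R)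
    (p c : R) :
    (forall j, measurable (B j)) -> (forall j, P (B j) = p%:E) ->
    (forall j, measurable_fun [set: T] (X j)) ->
    (forall j w, `|X j w| <= 1) ->
    (forall j (A C : set R), measurable A -> measurable C ->
      P ((\1_(B j) : T -> R) @^-1` A `&` X j @^-1` C) =
      P ((\1_(B j) : T -> R) @^-1` A) * P (X j @^-1` C))%E ->
    {ae P, forall w, \sum_j X j w = c} ->
  (\sum_j 'E_P[\1_(B j) \* X j] = (p * c)%:E)%E.
Proof.
move=> mB PB mX X1 indep Xc.
have iX j : P.-integrable [set: T] (EFin \o X j) by exact: integrable_le1.
have EX j : ('E_P[\1_(B j) \* X j] = \int[P]_w (p%:E * (X j w)%:E))%E.
  rewrite expectationM_indep ?expectation_indic ?PB//.
  - by rewrite unlock integralZl//; exact: iX.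
  - exact: integrable_indic.
  - apply: integrable_le1; first exact: measurable_funM.
    move=> w; rewrite normrM indicE; case: (w \in B j) => /=.
      by rewrite normr1 mul1r.
    by rewrite normr0 mul0r ler01.
  - exact: indep.
rewrite (eq_bigr _ (fun j _ => EX j)) -integral_sum//; last first.
  by move=> j; exact: (integrableZl measurableT p (iX j)).
rewrite (@ae_eq_integral _ _ _ _ _ (cst (p * c)%:E))//.
- by rewrite integral_cst//= probability_setT mule1.
- apply: emeasurable_sum => j; apply/measurable_EFinP/measurable_funM => //.
- apply: filterS Xc => w Xw _ /=.
  by under eq_bigr do rewrite -EFinM; rewrite sumEFin -mulr_sumr Xw.
Qed.

Lemma expectation_sqnorm_vvec {m n : nat} (M : T -> 'M[R]_(m, n))
    (z : 'I_n -> T -> R) (u : 'cV[R]_m) :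
    (forall i j, measurable_fun [set: T] (fun w => rownormalize (M w) i j)) ->
    (forall j, measurable_fun [set: T] (z j)) ->
    (forall j, bernoulli_half P (z j)) ->
    (forall i k, \sum_j 'E_P[\1_(z j @^-1` [set 1%R]) \*
        (fun w => rownormalize (M w) i j * rownormalize (M w) k j)%R] =
      (1 / 2 * (i == k)%:R)%:E)%E ->
  ('E_P[fun w => sqnorm (vvec (M w) (fun j => z j w) u)] = (sqnorm u)%:E)%E.
Proof.
move=> mf mz bern EM.
pose f i j w := rownormalize (M w) i j.
pose B j := z j @^-1` [set 1].
have mB j : measurable (B j).
  by rewrite -[B j]setTI; exact: (mz j).
pose c (p : 'I_m * 'I_m) := 2 * u p.1 ord0 * u p.2 ord0.
(* The indicator replaces [z j ^+ 2], which is controlled only almost surely; [h] is bounded by 1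
   everywhere, hence integrable. *)
pose h (p : 'I_m * 'I_m) j w := \1_(B j) w * (f p.1 j w * f p.2 j w) : R.
have ih p j : P.-integrable [set: T] (EFin \o h p j).
  apply: integrable_le1.
    apply: measurable_funM; first exact: measurable_indic.
    by apply: measurable_funM; exact: mf.
  move=> w; rewrite !normrM indicE normr_nat.
  by rewrite !mulr_ile1 ?mulr_ge0 ?rownormalize_le1 ?lern1 ?leq_b1 ?ler0n.
have iG p : P.-integrable [set: T] (fun w => \sum_j (h p j w)%:E)%E.
  by apply: integrable_sum => // j _; exact: ih.
(* The events [z j = 1] and [z j = 0] are disjoint with total mass 1, and the identity holds on
   both. *)
have z01 : {ae P, forall w, forall j, z j w ^+ 2 = \1_(B j) w}.
  apply: filter_forall => j.
  have mz0 : measurable (z j @^-1` [set 0]).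
    by rewrite -[X in measurable X]setTI; exact: (mz j).
  exists (~` (B j `|` z j @^-1` [set 0])); split.
  - by apply: measurableC; exact: measurableU.
  - rewrite probability_setC; last exact: measurableU.
    have -> : (P (B j `|` z j @^-1` [set 0%R]) =
        P (B j) + P (z j @^-1` [set 0%R]))%E.
      apply: measureU => //; apply/seteqP; split=> // w [/= -> /eqP].
      by rewrite oner_eq0.
    have [PB P0] := bern j.
    have half2 : 1 / 2 + 1 / 2 = 1 :> R by field.
    by rewrite P0 (PB : P (B j) = _) -EFinD half2 subrr.
  - move=> w; apply: contra_not => -[]/= zw; rewrite indicE.
      by rewrite mem_set// zw expr1n.
    rewrite memNset /B /= zw ?expr0n//.
    by move/esym/eqP; rewrite oner_eq0.
transitivity (\int[P]_w \sum_p (c p)%:E * \sum_j (h p j w)%:E)%E.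
  rewrite unlock; apply: ae_eq_integral => //.
  - under eq_fun do rewrite sqnorm_vvec.
    apply/measurable_EFinP; apply: measurable_sum => p.
    apply: measurable_funM => //; apply: measurable_sum => j.
    apply: measurable_funM; first exact: measurable_funX.
    by apply: measurable_funM; exact: mf.
  - apply: emeasurable_sum => p; apply: emeasurable_funM => //.
    by apply: emeasurable_sum => j; have /integrableP[] := ih p j.
  - apply: filterS z01 => w zw _; rewrite sqnorm_vvec -sumEFin.
    apply: eq_bigr => p _; rewrite EFinM; congr (_ * _)%E.
    by rewrite -sumEFin; apply: eq_bigr => j _; rewrite zw.
rewrite integral_sum//; last first.
  by move=> p; exact: (integrableZl measurableT (c p) (iG p)).
(* The 2 in [c p] cancels the Bernoulli 1/2, and only diagonal pairs survive. *)
transitivity (\sum_p (u p.1 ord0 * u p.2 ord0 * (p.1 == p.2)%:R)%:E)%E.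
  apply: eq_bigr => p _; rewrite (integralZl measurableT (iG p)).
  rewrite integral_sum//; last by move=> j; exact: ih.
  have -> : (\sum_j \int[P]_w (h p j w)%:E = (1 / 2 * (p.1 == p.2)%:R)%:E)%E.
    by rewrite -EM; apply: eq_bigr => j _; rewrite unlock.
  by rewrite -EFinM /c; congr (_%:E); field.
rewrite sumEFin -(pair_bigA _ (fun i k => u i ord0 * u k ord0 * (i == k)%:R))/=.
congr (_%:E); apply: eq_bigr => i _.
rewrite (bigD1 i)//= eqxx mulr1 big1 ?addr0 ?expr2//.
by move=> k ki; rewrite eq_sym (negbTE ki) mulr0.
Qed.

End SecondMoment.

(** * Events determined by a Bernoulli coordinate, and the vanishing of a row *)

Section Coordinates.
Context {d : measure_display} {T : measurableType d} {R : realType}.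

Lemma sigma_of_indic_eq (z : T -> R) (r : R) (A : set R) : measurable A ->
  sigma_of z ((\1_(z @^-1` [set r]) : T -> R) @^-1` A).
Proof.
move=> mA.
have := @sigma_of_comp _ T R _ z (\1_[set r]) A _ mA; apply.
apply: measurable_indic; exact: measurable_set1_borel.
Qed.

Lemma sigma_of_eq (z : T -> R) (r : R) : sigma_of z (z @^-1` [set r]).
Proof. by exists [set r] => //; exact: measurable_set1_borel. Qed.

Lemma sigma_of_neq (z : T -> R) (r : R) : sigma_of z (~` (z @^-1` [set r])).
Proof.
exists (~` [set r]) => //.
exact: (measurableC (measurable_set1_borel r)).
Qed.

Lemma rv_meas_real (z : T -> R) : rv_meas z -> measurable_fun [set: T] z.
Proof.
move=> mz; have := @rv_meas_comp _ T R _ z idfun mz; apply.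
by apply: continuous_borel => x; exact: cvg_id.
Qed.

End Coordinates.

(** The complement of the origin is open. This lets the event that a row vanishes serve as an
    exceptional null set. *)
Lemma rv_meas_set0 {d : measure_display} {T : measurableType d} {R : realType}
    {n : nat} (X : T -> 'rV[R]_n) : rv_meas X -> measurable (X @^-1` [set 0]).
Proof.
apply; rewrite -[X in borel_sets X]setCK.
apply: (@measurableC _ (g_sigma_algebraType (@open 'rV[R]_n))).
apply: sub_sigma_algebra; rewrite openC.
exact/accessible_closed_set1/hausdorff_accessible/norm_hausdorff.
Qed.

(** * The two models of the random matrix *)

Theorem theorem2 (R : realType) (d : measure_display) (T : measurableType d)
  (P : probability T R) (m n : nat) (u : 'cV[R]_m)
  (Rm : T -> 'M[R]_(m, n)) (z : 'I_n -> T -> R) :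
  (forall j, rv_meas (z j)) ->
  (forall j, bernoulli_half P (z j)) ->
  ( (* case 1: rows i.i.d. from an isotropic law, independent of the z_j *)
    ((forall i, rv_meas (fun w => row i (Rm w))) /\
     (forall i k, same_law P (fun w => row i (Rm w)) (fun w => row k (Rm w))) /\
     (forall i, isotropic_law P (fun w => row i (Rm w))) /\
     mutually_independent P (fun k : 'I_m + 'I_n =>
        match k with
        | inl i => sigma_of (fun w => row i (Rm w))
        | inr j => sigma_of (z j)
        end))
  \/
    (* case 2: \hat R has orthonormal rows, uniformly (rotation-invariantly)
       distributed, independent of the z_j *)
    (rv_meas Rm /\
     (forall w, rownormalize (Rm w) *m (rownormalize (Rm w))^T = 1%:M) /\
     (forall Q : 'M[R]_n, orthogonal_mx Q ->
        same_law P (fun w => rownormalize (Rm w))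
                   (fun w => rownormalize (Rm w) *m Q)) /\
     mutually_independent P (fun k : option 'I_n =>
        match k with
        | None => sigma_of Rm
        | Some j => sigma_of (z j)
        end)) ) ->
  ('E_P[fun w => sqnorm (vvec (Rm w) (fun j => z j w) u)] = (sqnorm u)%:E)%E.
Proof.
move=> mz bern H.
have mzR j : measurable_fun [set: T] (z j) by exact: rv_meas_real.
pose B j := z j @^-1` [set 1].
have mB j : measurable (B j) by rewrite -[B j]setTI; exact: (mzR j).
have f1 i k j w : `|rownormalize (Rm w) i j * rownormalize (Rm w) k j| <= 1.
  by rewrite normrM mulr_ile1 ?rownormalize_le1.
case: H => [[mR [_ [iso indep]]]|[mR [orthoR [_ indep]]]]; last first.
  (* Orthonormal rows: the product of two normalized entries is a function of the whole matrix,
     which is independent of each [z j]. *)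
  pose g i k j (M : 'M[R]_(m, n)) := rownormalize M i j * rownormalize M k j.
  have mg i k j : measurable_fun setT
      (g i k j : g_sigma_algebraType (@open 'M[R]_(m, n)) -> R).
    by apply: measurable_funM; exact: measurable_rownormalize.
  apply: expectation_sqnorm_vvec => // [i j|i k].
    exact: (rv_meas_comp _ _ mR (measurable_rownormalize i j)).
  apply: expectation_indic_sum => //.
  - by move=> j; have [] := bern j.
  - by move=> j; exact: (rv_meas_comp _ _ mR (mg i k j)).
  - move=> j A C mA mC.
    apply: (mutually_independent2 _ _ (Some j) None _ _ _ indep) => //.
    + by case=> [j'|]; exact: sigma_of_setT.
    + exact: sigma_of_indic_eq.
    + exact: (sigma_of_comp _ (g i k j)).
  - apply: aeW => w /=.
    have -> : (i == k)%:R = (rownormalize (Rm w) *m (rownormalize (Rm w))^T) i k.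
      by rewrite orthoR mxE.
    by rewrite [RHS]mxE; apply: eq_bigr => j _; congr (_ * _); rewrite [RHS]mxE.
(* Independent rows: measurability and independence are given row by row, so each entry is expressed
   through its own row, normalized as a one-row matrix. *)
pose X i w := row i (Rm w).
pose g j (x : 'rV[R]_n) := rownormalize x ord0 j.
have mg j : measurable_fun setT (g j : g_sigma_algebraType (@open 'rV[R]_n) -> R).
  exact: measurable_rownormalize.
have fE i j w : rownormalize (Rm w) i j = g j (X i w).
  by rewrite /g rownormalize_row.
have ffE i k j : (fun w => rownormalize (Rm w) i j * rownormalize (Rm w) k j) =
    (g j \o X i) \* (g j \o X k).
  by apply/funext => w /=; rewrite !fE.
have mf i j : measurable_fun [set: T] (g j \o X i).
  exact: (rv_meas_comp _ _ (mR i) (mg j)).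
have FT (k : 'I_m + 'I_n) : match k with
    | inl i => sigma_of (X i) | inr j => sigma_of (z j) end setT.
  by case: k => ?; exact: sigma_of_setT.
apply: expectation_sqnorm_vvec => // [i j|i k].
  by under eq_fun do rewrite fE; exact: mf.
have [<-{k}|ik] := eqVneq i k.
  apply: expectation_indic_sum => //.
  - by move=> j; have [] := bern j.
  - by move=> j; rewrite ffE; apply: measurable_funM; exact: mf.
  - move=> j A C mA mC.
    apply: (mutually_independent2 _ _ (inr j) (inl i) _ _ FT indep) => //.
    + exact: sigma_of_indic_eq.
    + rewrite ffE.
      apply: (sigma_of_comp _ (fun x => g j x * g j x)) => //.
      exact: measurable_funM.
  (* Row [i] is almost surely nonzero, and then its normalization has squared norm 1. *)
  - have [_ Xi0] := iso i.
    exists (X i @^-1` [set 0]); split => //; first exact: (rv_meas_set0 _ (mR i)).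
    move=> w; apply: contra_notP => /eqP Xiw.
    rewrite -(sum_rownormalize_sqr _ _ Xiw).
    by apply: eq_bigr => j _; rewrite expr2.
rewrite mulr0 big1// => j _.
have le1 l w : `|g j (X l w)| <= 1 by exact: rownormalize_le1.
have iX l : P.-integrable [set: T] (EFin \o (g j \o X l)).
  by apply: integrable_le1; [exact: mf|exact: le1].
have mBY : measurable_fun [set: T] (\1_(B j) \* (g j \o X k)).
  by apply: measurable_funM => //; exact: measurable_indic.
have BY1 w : `|(\1_(B j) \* (g j \o X k)) w| <= 1.
  by rewrite /= normrM indicE normr_nat mulr_ile1 ?lern1 ?leq_b1 ?ler0n ?le1.
(* For distinct rows every term vanishes separately: regrouping isolates the factor from row [i],
   whose mean is zero. *)
have -> : \1_(B j) \* (fun w => rownormalize (Rm w) i j * rownormalize (Rm w) k j)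
    = (g j \o X i) \* (\1_(B j) \* (g j \o X k)).
  by rewrite ffE; apply/funext => w /=; rewrite mulrCA.
rewrite expectationM_indep//.
- rewrite expectation_symmetric ?mul0e//.
  move=> A mA; have [isoi _] := iso i.
  (* Isotropy applied to [- 1%:M] makes the entry symmetric, as normalization is odd. *)
  have QN : orthogonal_mx (- 1%:M : 'M[R]_n).
    by rewrite /orthogonal_mx linearN/= trmx1 mulNmx mulmxN opprK mulmx1.
  rewrite (same_law_comp _ _ _ _ _ (isoi _ QN) (mg j) mA); congr (P (_ @^-1` A)).
  by apply/funext => w /=; rewrite mulmxN mulmx1 /g rownormalizeN.
- exact: integrable_le1.
- apply: integrable_le1; first exact: measurable_funM.
  by move=> w; rewrite normrM; apply: mulr_ile1 => //; exact: le1.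
- apply: indep_indicM => // A C D mA mC DB.
  apply: (mutually_independent3 _ _ (inl i) (inl k) (inr j) _ _ _ FT indep) => //.
  + exact: sigma_of_comp.
  + exact: sigma_of_comp.
  + by case: DB => ->; [exact: sigma_of_eq|exact: sigma_of_neq].
Qed.
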